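(* Let $A\in\mathbb{R}^{n_x\times n_x}$, $C\in\mathbb{R}^{n_x\times n_c}$, $D\in\mathbb{R}^{n_c\times n_x}$, $F\in\mathbb{R}^{n_c\times n_c}$, and consider the DLCS $$x_{k+1}=Ax_k+C\lambda_{k+1},\qquad 0\le \lambda_{k+1}\perp Dx_k+F\lambda_{k+1}\ge 0 .$$ Assume that $F$ is a Q-matrix and an R$_0$-matrix. For $P_{xx}\in\mathbb{S}^{n_x}$, $P_{\lambda\lambda}\in\mathbb{S}^{n_c}$, $P_{x\lambda}\in\mathbb{R}^{n_x\times n_c}$, let $P=\begin{pmatrix}P_{xx}&P_{x\lambda}\\P_{x\lambda}^T&P_{\lambda\lambda}\end{pmatrix}$, and let $$\widehat\psi(x,\lambda,\widehat\lambda)=\begin{pmatrix}x\\ \lambda\\ \widehat\lambda\end{pmatrix}^T\widehat M(P)\begin{pmatrix}x\\ \lambda\\ \widehat\lambda\end{pmatrix},$$ $$\widehat M(P)=\begin{pmatrix}A^TP_{xx}A-P_{xx} & A^TP_{xx}C-P_{x\lambda} & A^TP_{x\lambda}\\ C^TP_{xx}A-P_{x\lambda}^T & C^TP_{xx}C-P_{\lambda\lambda} & C^TP_{x\lambda}\\ P_{x\lambda}^TA & P_{x\lambda}^TC & P_{\lambda\lambda}\end{pmatrix}.$$ Suppose there exist $P_{xx},P_{x\lambda},P_{\lambda\lambda}$ such that the function $$\widehat V(x,\lambda)=\begin{pmatrix}x\\ \lambda\end{pmatrix}^TP\begin{pmatrix}x\\ \lambda\end{pmatrix}$$ satisfies,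 for all $(x,\lambda)\in\mathrm{Gr}\,\mathrm{SOL}(Dx,F)$, $\widehat V(x,\lambda)\ge 0$, with $\widehat V(x,\lambda)=0$ if and only if $(x,\lambda)=(0,0)$. Then $(x^e,\lambda^e)=(0,0)$ is (i) stable if $\widehat\psi(x,\lambda,\widehat\lambda)\le0$ for all $(x,\lambda)\in\mathrm{Gr}\,\mathrm{SOL}(Dx,F)$ and $\widehat\lambda\in\mathrm{SOL}(D(Ax+C\lambda),F)$; and (ii) exponentially stable if $\widehat\psi(x,\lambda,\widehat\lambda)<0$ for all nonzero $(x,\lambda)\in\mathrm{Gr}\,\mathrm{SOL}(Dx,F)$ and $\widehat\lambda\in\mathrm{SOL}(D(Ax+C\lambda),F)$.
   Context: $\mathbb{S}^n$ denotes the real symmetric $n\times n$ matrices. For $q\in\mathbb{R}^{n_c}$ and $M\in\mathbb{R}^{n_c\times n_c}$, $\mathrm{SOL}(q,M)$ is the set of $\lambda\in\mathbb{R}^{n_c}$ with $0\le\lambda\perp M\lambda+q\ge 0$ (i.e. $\lambda\ge0$, $M\lambda+q\ge0$ componentwise, $\lambda^T(M\lambda+q)=0$). $M$ is a Q-matrix if $\mathrm{SOL}(q,M)\neq\emptyset$ for all $q$; $M$ is an R$_0$-matrix if $\mathrm{SOL}(0,M)=\{0\}$. $\mathrm{Gr}\,\mathrm{SOL}(Dx,F)=\{(x,\lambda): \lambda\in\mathrm{SOL}(Dx,F)\}\subseteq\mathbb{R}^{n_x+n_c}$. A trajectory of the DLCS from an initial state $x_0$ consists of $(x_k)_{k\ge0}$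 and $(\lambda_k)_{k\ge1}$ with $\lambda_{k+1}\in\mathrm{SOL}(Dx_k,F)$ and $x_{k+1}=Ax_k+C\lambda_{k+1}$ for all $k\ge0$; trajectories need not be unique. The equilibrium $(x^e,\lambda^e)=(0,0)$ is - stable (in the sense of Lyapunov) if for each $\epsilon>0$ there is $\delta_\epsilon>0$ such that $\|(x_0,\lambda_1)\|<\delta_\epsilon$ implies $\|(x_k,\lambda_{k+1})\|<\epsilon$ for all $k\in\mathbb{Z}_+$ and all trajectories; - exponentially stable if there are scalars $\delta>0$, $c>0$, $0\le\mu<1$ such that $\|(x_0,\lambda_1)\|<\delta$ implies $\|(x_k,\lambda_{k+1})\|\le c\mu^k\|(x_0,\lambda_1)\|$ for all $k\in\mathbb{Z}_+$ and all trajectories. *)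

(* Defs.v *)
From HB Require Import structures.
From mathcomp Require Import all_boot all_order all_algebra.
From mathcomp Require Import classical_sets reals.

Set Implicit Arguments.
Unset Strict Implicit.
Unset Printing Implicit Defensive.

Import Order.TTheory GRing.Theory Num.Theory.

Local Open Scope classical_set_scope.
Local Open Scope ring_scope.

Definition qform (R : realType) (n : nat) (M : 'M[R]_n) (v : 'cV[R]_n) : R :=
  (v^T *m M *m v) 0 0.

(* The Euclidean norm; the library's norm on matrices is the max norm. *)
Definition enorm (R : realType) (n : nat) (v : 'cV[R]_n) : R :=
  Num.sqrt (\sum_(i < n) v i 0 ^+ 2).

Definition nonneg_cV (R : realType) (n : nat) (v : 'cV[R]_n) : Prop :=
  forall i : 'I_n, 0 <= v i 0.

Definition SOL (R : realType) (n : nat) (q : 'cV[R]_n) (M : 'M[R]_n) :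
    set 'cV[R]_n :=
  [set l | [/\ nonneg_cV l, nonneg_cV (M *m l + q)
             & (l^T *m (M *m l + q)) 0 0 = 0]].

Definition Q_matrix (R : realType) (n : nat) (M : 'M[R]_n) : Prop :=
  forall q : 'cV[R]_n, SOL q M !=set0.

Definition R0_matrix (R : realType) (n : nat) (M : 'M[R]_n) : Prop :=
  SOL 0 M = [set 0].

(* A pair (x, lambda) is represented by the stacked vector col_mx x lambda. *)
Definition GrSOL (R : realType) (nx nc : nat)
    (D : 'M[R]_(nc, nx)) (F : 'M[R]_nc) : set 'cV[R]_(nx + nc) :=
  [set v | SOL (D *m usubmx v) F (dsubmx v)].

(* The sequence l is indexed from 1: the value l 0 is irrelevant. *)
Definition trajectory (R : realType) (nx nc : nat)
    (A : 'M[R]_nx) (C : 'M[R]_(nx, nc)) (D : 'M[R]_(nc, nx)) (F : 'M[R]_nc)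
    (x : nat -> 'cV[R]_nx) (l : nat -> 'cV[R]_nc) : Prop :=
  forall k : nat, SOL (D *m x k) F (l k.+1)
               /\ x k.+1 = A *m x k + C *m l k.+1.

Definition stable (R : realType) (nx nc : nat)
    (A : 'M[R]_nx) (C : 'M[R]_(nx, nc)) (D : 'M[R]_(nc, nx)) (F : 'M[R]_nc) :
    Prop :=
  forall eps : R, 0 < eps ->
  exists2 delta : R, 0 < delta &
    forall (x : nat -> 'cV[R]_nx) (l : nat -> 'cV[R]_nc),
      trajectory A C D F x l ->
      enorm (col_mx (x 0%N) (l 1%N)) < delta ->
      forall k : nat, enorm (col_mx (x k) (l k.+1)) < eps.

Definition exponentially_stable (R : realType) (nx nc : nat)
    (A : 'M[R]_nx) (C : 'M[R]_(nx, nc)) (D : 'M[R]_(nc, nx)) (F : 'M[R]_nc) :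
    Prop :=
  exists delta c mu : R, [/\ 0 < delta, 0 < c, 0 <= mu < 1 &
    forall (x : nat -> 'cV[R]_nx) (l : nat -> 'cV[R]_nc),
      trajectory A C D F x l ->
      enorm (col_mx (x 0%N) (l 1%N)) < delta ->
      forall k : nat, enorm (col_mx (x k) (l k.+1))
                      <= c * mu ^+ k * enorm (col_mx (x 0%N) (l 1%N))].

Definition Pmx (R : realType) (nx nc : nat)
    (Pxx : 'M[R]_nx) (Pxl : 'M[R]_(nx, nc)) (Pll : 'M[R]_nc) :
    'M[R]_(nx + nc) :=
  block_mx Pxx Pxl Pxl^T Pll.

Definition Vhat (R : realType) (nx nc : nat)
    (Pxx : 'M[R]_nx) (Pxl : 'M[R]_(nx, nc)) (Pll : 'M[R]_nc)
    (x : 'cV[R]_nx) (l : 'cV[R]_nc) : R :=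
  qform (Pmx Pxx Pxl Pll) (col_mx x l).

Definition Mhat (R : realType) (nx nc : nat)
    (A : 'M[R]_nx) (C : 'M[R]_(nx, nc))
    (Pxx : 'M[R]_nx) (Pxl : 'M[R]_(nx, nc)) (Pll : 'M[R]_nc) :
    'M[R]_(nx + nc + nc) :=
  block_mx
    (block_mx (A^T *m Pxx *m A - Pxx)    (A^T *m Pxx *m C - Pxl)
              (C^T *m Pxx *m A - Pxl^T)  (C^T *m Pxx *m C - Pll))
    (col_mx (A^T *m Pxl)
            (C^T *m Pxl))
    (row_mx (Pxl^T *m A) (Pxl^T *m C))
    Pll.

Definition psihat (R : realType) (nx nc : nat)
    (A : 'M[R]_nx) (C : 'M[R]_(nx, nc))
    (Pxx : 'M[R]_nx) (Pxl : 'M[R]_(nx, nc)) (Pll : 'M[R]_nc)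
    (x : 'cV[R]_nx) (l lh : 'cV[R]_nc) : R :=
  qform (Mhat A C Pxx Pxl Pll) (col_mx (col_mx x l) lh).

(* Main.v *)
(** On the graph cone GrSOL the form Vhat is positive definite, hence by
    compactness of the unit sphere it is squeezed between two multiples of the
    squared norm; psihat is exactly the increment of Vhat along a step.  For
    exponential stability the triples (x, l, lh) also form a closed cone, and
    the R0 property forces lh = 0 as soon as (x, l) = 0, so psihat is negative
    definite on that cone and Vhat decays geometrically. *)
Require Import Defs.
From mathcomp Require Import all_boot all_order all_algebra.
From mathcomp Require Import boolp classical_sets reals.
From mathcomp Require Import topology normedtype derive.
From mathcomp Require Import ring.

Set Implicit Arguments.
Unset Strict Implicit.
Unset Printing Implicit Defensive.

Import Order.TTheory GRing.Theory Num.Theory.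
Import numFieldNormedType.Exports.

Local Open Scope classical_set_scope.
Local Open Scope ring_scope.

(** * Entrywise continuity and closedness of complementarity solution sets *)

Definition entrywise_continuous (R : realType) (T : topologicalType) (m n : nat)
    (g : T -> 'M[R]_(m, n)) : Prop :=
  forall i j, continuous (fun u => g u i j : R).

Section EntrywiseContinuity.
Variables (R : realType) (T : topologicalType).

Lemma entrywise_continuous_cst (m n : nat) (M : 'M[R]_(m, n)) :
  entrywise_continuous (fun _ : T => M).
Proof. by move=> i j; exact: cst_continuous. Qed.

Lemma entrywise_continuousD (m n : nat) (f g : T -> 'M[R]_(m, n)) :
  entrywise_continuous f -> entrywise_continuous g ->
  entrywise_continuous (fun u => f u + g u).
Proof.
move=> cf cg i j; under eq_fun do rewrite mxE.
by move=> u; apply: continuousD; [exact: cf | exact: cg].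
Qed.

Lemma entrywise_continuousM (m n p : nat) (f : T -> 'M[R]_(m, n))
    (g : T -> 'M[R]_(n, p)) :
  entrywise_continuous f -> entrywise_continuous g ->
  entrywise_continuous (fun u => f u *m g u).
Proof.
move=> cf cg i j; under eq_fun do rewrite mxE.
apply: continuous_big => [|k _ u]; first exact: add_continuous.
by apply: continuousM; [exact: cf | exact: cg].
Qed.

Lemma entrywise_continuous_tr (m n : nat) (f : T -> 'M[R]_(m, n)) :
  entrywise_continuous f -> entrywise_continuous (fun u => (f u)^T).
Proof. by move=> cf i j; under eq_fun do rewrite mxE; exact: cf. Qed.

Lemma entrywise_continuous_usub (m1 m2 n : nat) (f : T -> 'M[R]_(m1 + m2, n)) :
  entrywise_continuous f -> entrywise_continuous (fun u => usubmx (f u)).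
Proof. by move=> cf i j; under eq_fun do rewrite mxE; exact: cf. Qed.

Lemma entrywise_continuous_dsub (m1 m2 n : nat) (f : T -> 'M[R]_(m1 + m2, n)) :
  entrywise_continuous f -> entrywise_continuous (fun u => dsubmx (f u)).
Proof. by move=> cf i j; under eq_fun do rewrite mxE; exact: cf. Qed.

Lemma closed_nonneg_cV (n : nat) (g : T -> 'cV[R]_n) :
  entrywise_continuous g -> closed [set u | nonneg_cV (g u)].
Proof.
move=> cg.
have -> : [set u | nonneg_cV (g u)] =
    \bigcap_(i in [set: 'I_n]) ((fun u => g u i 0) @^-1` [set y : R | 0 <= y]).
  by apply/seteqP; split => [u gu i _|u gu i]; [exact: gu | exact: (gu i)].
apply: closed_bigI => i _; apply: preimage_closed; last exact: closed_ge.
by move=> u _; exact: cg.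
Qed.

(** Each condition in [SOL] pulls back a closed set of reals along continuous scalar maps. Since [q]
    and [l] vary together, this covers both the graph of [SOL] and the set of step triples. *)
Lemma closed_SOL (n : nat) (F : 'M[R]_n) (q l : T -> 'cV[R]_n) :
  entrywise_continuous q -> entrywise_continuous l ->
  closed [set u | SOL (q u) F (l u)].
Proof.
move=> cq cl.
have cw : entrywise_continuous (fun u => F *m l u + q u).
  apply: entrywise_continuousD cq; apply: entrywise_continuousM cl.
  exact: entrywise_continuous_cst.
have cs := entrywise_continuousM (entrywise_continuous_tr cl) cw.
have -> : [set u | SOL (q u) F (l u)] =
    [set u | nonneg_cV (l u)] `&` [set u | nonneg_cV (F *m l u + q u)] `&`
    ((fun u => ((l u)^T *m (F *m l u + q u)) 0 0) @^-1` [set y : R | y = 0]).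
  by apply/seteqP; split => [u [? ? ?]|u [[? ?] ?]].
apply: closedI; first by apply: closedI; exact: closed_nonneg_cV.
apply: preimage_closed; last exact: closed_eq.
by move=> u _; exact: cs.
Qed.

End EntrywiseContinuity.

(* Closedness of cones of columns is stated through row vectors, because the
   library's Heine-Borel theorem is about 'rV. *)
Lemma entrywise_continuous_id_tr (R : realType) (n : nat) :
  entrywise_continuous (fun u : 'rV[R]_n => u^T).
Proof.
move=> i j; under eq_fun do rewrite mxE.
exact: coord_continuous.
Qed.

Lemma continuous_qform_tr (R : realType) (n : nat) (M : 'M[R]_n) :
  continuous (fun u : 'rV[R]_n => qform M u^T).
Proof.
have cT := @entrywise_continuous_id_tr R n.
have cM := @entrywise_continuous_cst R 'rV[R]_n n n M.
exact: (entrywise_continuousM (entrywise_continuousM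
         (entrywise_continuous_tr cT) cM) cT) 0 0.
Qed.

(** * Euclidean norm and quadratic forms on cones *)

Section QuadraticForms.
Variable R : realType.

Lemma enorm_ge0 (n : nat) (v : 'cV[R]_n) : 0 <= enorm v.
Proof. exact: sqrtr_ge0. Qed.

(** Seen as a quadratic form, the squared norm inherits the continuity and degree-two homogeneity of
    [qform]. *)
Lemma sqr_enorm (n : nat) (v : 'cV[R]_n) : enorm v ^+ 2 = qform 1%:M v.
Proof.
rewrite /enorm sqr_sqrtr; last by apply: sumr_ge0 => i _; exact: sqr_ge0.
by rewrite /qform mulmx1 mxE; apply: eq_bigr => i _; rewrite mxE expr2.
Qed.

Lemma sqr_enorm_sum (n : nat) (v : 'cV[R]_n) :
  enorm v ^+ 2 = \sum_(i < n) v i 0 ^+ 2.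
Proof. by rewrite sqr_sqrtr// sumr_ge0// => i _; exact: sqr_ge0. Qed.

Lemma enorm_eq0 (n : nat) (v : 'cV[R]_n) : enorm v = 0 -> v = 0.
Proof.
move=> v0; apply/matrixP => i j; rewrite ord1 mxE; apply/eqP.
have /eqP := sqr_enorm_sum v; rewrite v0 expr0n eq_sym psumr_eq0.
  by move=> /allP/(_ i (mem_index_enum i)) /=; rewrite sqrf_eq0.
by move=> k _; exact: sqr_ge0.
Qed.

Lemma ler_entry_enorm (n : nat) (v : 'cV[R]_n) (i : 'I_n) :
  `|v i 0| <= enorm v.
Proof.
rewrite -(ler_pXn2r (ltn0Sn 1)) ?nnegrE ?enorm_ge0// real_normK ?num_real//.
rewrite sqr_enorm_sum (bigD1 i)//= lerDl sumr_ge0// => k _; exact: sqr_ge0.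
Qed.

Lemma enormZ (n : nat) (t : R) (v : 'cV[R]_n) :
  0 <= t -> enorm (t *: v) = t * enorm v.
Proof.
move=> t0; rewrite /enorm -{2}(ger0_norm t0) -sqrtr_sqr.
by rewrite -sqrtrM ?sqr_ge0// mulr_sumr; congr Num.sqrt;
  apply: eq_bigr => i _; rewrite mxE exprMn.
Qed.

Lemma enorm_usub (m n : nat) (w : 'cV[R]_(m + n)) :
  enorm (usubmx w) <= enorm w.
Proof.
apply: ler_wsqrtr; rewrite big_split_ord /=.
under eq_bigr do rewrite mxE.
by rewrite lerDl sumr_ge0// => i _; exact: sqr_ge0.
Qed.

Lemma qformZ (n : nat) (M : 'M[R]_n) (t : R) (v : 'cV[R]_n) :
  qform M (t *: v) = t ^+ 2 * qform M v.
Proof.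
rewrite /qform [(t *: v)^T]linearZ /= -!scalemxAl -scalemxAr.
by rewrite 2!mxE mulrA expr2.
Qed.

Lemma qformN (n : nat) (M : 'M[R]_n) (v : 'cV[R]_n) :
  qform (- M) v = - qform M v.
Proof. by rewrite /qform mulmxN mulNmx mxE. Qed.

Lemma qform_le_enorm (n : nat) (M : 'M[R]_n) :
  exists2 b : R, 0 < b & forall v, qform M v <= b * enorm v ^+ 2.
Proof.
(* Every product of two entries of [v] is at most [enorm v ^+ 2] in absolute value; the summand 1
   keeps the constant positive even when [M] is zero. *)
exists (1 + \sum_j \sum_i `|M i j|).
  by rewrite ltr_pwDl// sumr_ge0// => i _; apply: sumr_ge0.
move=> v; rewrite mulrDl mul1r.
apply: (@le_trans _ _ ((\sum_j \sum_i `|M i j|) * enorm v ^+ 2)); last first.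
  by rewrite lerDr sqr_ge0.
rewrite /qform mxE mulr_suml; apply: ler_sum => j _.
rewrite mxE !mulr_suml; apply: ler_sum => i _; rewrite mxE.
apply: le_trans (ler_norm _) _.
rewrite !normrM [`|v i 0| * _]mulrC -mulrA expr2.
by apply: ler_wpM2l => //; apply: ler_pM => //; exact: ler_entry_enorm.
Qed.

(** On the compact slice of [K] by the unit sphere the form attains its minimum, which is positive
    and serves as [a]; homogeneity carries the bound to all of [K]. *)
Lemma qform_ge_enorm_cone (n : nat) (K : set 'cV[R]_n) (M : 'M[R]_n) :
  closed [set u : 'rV[R]_n | K u^T] ->
  (forall t v, 0 <= t -> K v -> K (t *: v)) ->
  (forall v, K v -> v <> 0 -> 0 < qform M v) ->
  exists2 a : R, 0 < a & forall v, K v -> a * enorm v ^+ 2 <= qform M v.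
Proof.
move=> Kcl Kcone Mpos.
pose S := [set u : 'rV[R]_n | K u^T /\ qform 1%:M u^T = 1].
have Scl : closed S.
  have -> : S = [set u : 'rV[R]_n | K u^T] `&`
      ((fun u : 'rV[R]_n => qform 1%:M u^T) @^-1` [set y : R | y = 1]) by [].
  apply: closedI => //; apply: preimage_closed; last exact: closed_eq.
  by move=> u _; exact: continuous_qform_tr.
(* Boundedness refers to the max norm, which is dominated by the Euclidean norm, equal to 1 on
   [S]. *)
have Sbd : bounded_set S.
  exists 1; split; first exact: num_real.
  move=> y y1 u [_ u1] /=; rewrite [leLHS]/Num.norm /= mx_normrE.
  apply: bigmax_le => [|[i j] _ /=]; first exact: le_trans ler01 (ltW y1).
  have := ler_entry_enorm u^T j; rewrite mxE (ord1 i) => /le_trans; apply.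
  apply: le_trans (ltW y1).
  by rewrite -(ler_pXn2r (ltn0Sn 1)) ?nnegrE ?enorm_ge0// sqr_enorm u1 expr1n.
have normalize v : v <> 0 -> K v -> S ((enorm v)^-1 *: v)^T.
  move=> v0 Kv; have e0 : enorm v != 0 by apply/eqP => /enorm_eq0.
  rewrite /S /= trmxK; split.
    by apply: Kcone; rewrite ?invr_ge0 ?enorm_ge0.
  by rewrite qformZ -sqr_enorm -exprMn mulVf ?expr1n.
(* If the slice is empty, [K] has no nonzero vector and any positive constant works. *)
have [S0|/set0P[u0 Su0]] := eqVneq S set0.
  exists 1 => // v Kv; have [->|/eqP v0] := eqVneq v 0.
    by rewrite sqr_enorm /qform !mulmx0 !mxE mulr0.
  by have := normalize _ v0 Kv; rewrite S0.
have [c Sc cmin] : exists2 c, c \in S &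
    forall u, u \in S -> qform M c^T <= qform M u^T.
  apply: (@EVT_min_rV R n (fun u => qform M u^T)).
  - by exists u0.
  - exact: bounded_closed_compact.
  - exact/continuous_subspaceT/continuous_qform_tr.
move: Sc; rewrite inE => -[Kc c1].
have c0 : c^T <> 0.
  move=> c0; have /eqP := c1.
  by rewrite c0 /qform !mulmx0 mxE eq_sym oner_eq0.
exists (qform M c^T) => [|v Kv]; first exact: Mpos.
have [->|/eqP v0] := eqVneq v 0.
  by rewrite sqr_enorm /qform !mulmx0 !mxE mulr0.
have := cmin _ (mem_set (normalize _ v0 Kv)).
rewrite trmxK qformZ exprVn mulrC ler_pdivlMr//.
rewrite exprn_gt0// lt_neqAle enorm_ge0 andbT eq_sym.
by apply/eqP => /enorm_eq0.
Qed.

End QuadraticForms.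

(** * Solution cones of the system, increment of the Lyapunov function, and decay along
    trajectories *)

Section DLCS.
Variables (R : realType) (nx nc : nat).
Variables (A : 'M[R]_nx) (C : 'M[R]_(nx, nc)).
Variables (D : 'M[R]_(nc, nx)) (F : 'M[R]_nc).
Variables (Pxx : 'M[R]_nx) (Pxl : 'M[R]_(nx, nc)) (Pll : 'M[R]_nc).

(* Triples (x, l, lh) stacked as columns, with the blocks of Mhat. *)
Definition step_graph : set 'cV[R]_(nx + nc + nc) :=
  [set w | GrSOL D F (usubmx w) /\
           SOL (D *m (A *m usubmx (usubmx w) + C *m dsubmx (usubmx w))) F
               (dsubmx w)].

(** The residual [F *m l + q] is linear in the pair, so it scales by [t] and the complementarity
    product by [t ^+ 2]. *)
Lemma SOL_scale (q l : 'cV[R]_nc) (t : R) :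
  0 <= t -> SOL q F l -> SOL (t *: q) F (t *: l).
Proof.
move=> t0 [l0 w0 lw]; split.
- by move=> i; rewrite mxE mulr_ge0.
- by move=> i; rewrite -scalemxAr -scalerDr mxE mulr_ge0.
- rewrite -scalemxAr -scalerDr [(t *: l)^T]linearZ /= -scalemxAl -scalemxAr.
  by rewrite 2!mxE lw !mulr0.
Qed.

Lemma GrSOL_scale (t : R) (v : 'cV[R]_(nx + nc)) :
  0 <= t -> GrSOL D F v -> GrSOL D F (t *: v).
Proof. by move=> t0 /(SOL_scale t0); rewrite /GrSOL /= !linearZ. Qed.

Lemma step_graph_scale (t : R) (w : 'cV[R]_(nx + nc + nc)) :
  0 <= t -> step_graph w -> step_graph (t *: w).
Proof.
move=> t0 [/(GrSOL_scale t0) Gw /(SOL_scale t0) Sw]; rewrite /step_graph /=.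
by rewrite !linearZ /= -scalerDr linearZ.
Qed.

Lemma closed_GrSOL_tr :
  closed [set u : 'rV[R]_(nx + nc) | GrSOL D F u^T].
Proof.
have cT := @entrywise_continuous_id_tr R (nx + nc).
have cD := @entrywise_continuous_cst R 'rV[R]_(nx + nc) _ _ D.
exact: closed_SOL (entrywise_continuousM cD (entrywise_continuous_usub cT))
  (entrywise_continuous_dsub cT).
Qed.

Lemma closed_step_graph_tr :
  closed [set u : 'rV[R]_(nx + nc + nc) | step_graph u^T].
Proof.
have cT := @entrywise_continuous_id_tr R (nx + nc + nc).
have cv := entrywise_continuous_usub cT.
have cx := entrywise_continuous_usub cv.
have cl := entrywise_continuous_dsub cv.
have cst m n := @entrywise_continuous_cst R 'rV[R]_(nx + nc + nc) m n.
have cAC := entrywise_continuousD (entrywise_continuousM (cst _ _ A) cx)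
  (entrywise_continuousM (cst _ _ C) cl).
apply: closedI.
  exact: closed_SOL (entrywise_continuousM (cst _ _ D) cx) cl.
exact: closed_SOL (entrywise_continuousM (cst _ _ D) cAC)
  (entrywise_continuous_dsub cT).
Qed.

Lemma psihatE (x : 'cV[R]_nx) (l lh : 'cV[R]_nc) :
  psihat A C Pxx Pxl Pll x l lh =
  Vhat Pxx Pxl Pll (A *m x + C *m l) lh - Vhat Pxx Pxl Pll x l.
Proof.
(* Once products are expanded and reassociated, both sides contain the same 1 by 1 products; passing
   to scalar entries lets [ring] treat these as atoms. *)
have mxD11 (X Y : 'M[R]_1) : (X + Y) 0 0 = X 0 0 + Y 0 0 by rewrite mxE.
have mxN11 (X : 'M[R]_1) : (- X) 0 0 = - X 0 0 by rewrite mxE.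
rewrite /psihat /Vhat /qform /Mhat /Pmx !tr_col_mx !mul_row_block.
rewrite !mul_row_col !mul_mx_row !add_row_mx !mul_row_col.
rewrite [(A *m x + C *m l)^T]linearD /= !trmx_mul.
rewrite !(mulmxDl, mulmxDr, mulmxN, mulNmx) !mulmxA.
rewrite !(mxD11, mxN11); ring.
Qed.

Lemma trajectory_GrSOL (x : nat -> 'cV[R]_nx) (l : nat -> 'cV[R]_nc) (k : nat) :
  trajectory A C D F x l -> GrSOL D F (col_mx (x k) (l k.+1)).
Proof. by case/(_ k) => xl _; rewrite /GrSOL /= col_mxKu col_mxKd. Qed.

Lemma Vhat_trajectoryS (x : nat -> 'cV[R]_nx) (l : nat -> 'cV[R]_nc) (k : nat) :
  trajectory A C D F x l ->
  Vhat Pxx Pxl Pll (x k.+1) (l k.+2) =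
  Vhat Pxx Pxl Pll (x k) (l k.+1)
  + psihat A C Pxx Pxl Pll (x k) (l k.+1) (l k.+2).
Proof. by case/(_ k) => _ ->; rewrite psihatE [RHS]addrC subrK. Qed.

(** Writing v_k for the stacked state and V_k for its [Vhat] value, a |v_k|^2 <= V_k <= r^k V_0 <=
    r^k b |v_0|^2; then take square roots. The case r = 1 serves stability, r < 1 exponential
    stability. *)
Lemma trajectory_decay (a b r : R)
    (x : nat -> 'cV[R]_nx) (l : nat -> 'cV[R]_nc) :
  0 < a -> 0 < b -> 0 <= r ->
  (forall v, GrSOL D F v -> a * enorm v ^+ 2 <= qform (Pmx Pxx Pxl Pll) v) ->
  (forall v, qform (Pmx Pxx Pxl Pll) v <= b * enorm v ^+ 2) ->
  trajectory A C D F x l ->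
  (forall k, Vhat Pxx Pxl Pll (x k.+1) (l k.+2)
             <= r * Vhat Pxx Pxl Pll (x k) (l k.+1)) ->
  forall k, enorm (col_mx (x k) (l k.+1)) <=
    Num.sqrt (b / a) * Num.sqrt r ^+ k * enorm (col_mx (x 0%N) (l 1%N)).
Proof.
move=> a0 b0 r0 aV Vb xl Vr k.
have Vk : Vhat Pxx Pxl Pll (x k) (l k.+1)
          <= r ^+ k * Vhat Pxx Pxl Pll (x 0%N) (l 1%N).
  elim: k => [|k IHk]; first by rewrite expr0 mul1r.
  by apply: le_trans (Vr k) _; rewrite exprS -mulrA ler_wpM2l.
rewrite -(ler_pXn2r (ltn0Sn 1)) ?nnegrE ?mulr_ge0 ?exprn_ge0 ?sqrtr_ge0//.
have ba0 : 0 <= b / a by rewrite divr_ge0// ltW.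
rewrite !exprMn exprAC (sqr_sqrtr ba0) (sqr_sqrtr r0).
rewrite -(ler_pM2l a0) [leRHS]mulrA [a * (b / a * _)]mulrA.
rewrite [a * (b / a)]mulrC divfK ?gt_eqF//.
apply: le_trans (aV _ (trajectory_GrSOL k xl)) _; apply: le_trans Vk _.
by rewrite [b * _]mulrC -mulrA ler_wpM2l ?exprn_ge0//; exact: Vb.
Qed.

End DLCS.

Theorem theorem2 (R : realType) (nx nc : nat)
    (A : 'M[R]_nx) (C : 'M[R]_(nx, nc)) (D : 'M[R]_(nc, nx)) (F : 'M[R]_nc)
    (hQ : Q_matrix F) (hR0 : R0_matrix F)
    (Pxx : 'M[R]_nx) (Pxl : 'M[R]_(nx, nc)) (Pll : 'M[R]_nc)
    (hPxx : Pxx^T = Pxx) (hPll : Pll^T = Pll)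
    (hV : forall (x : 'cV[R]_nx) (l : 'cV[R]_nc), GrSOL D F (col_mx x l) ->
       0 <= Vhat Pxx Pxl Pll x l
       /\ (Vhat Pxx Pxl Pll x l = 0 <-> col_mx x l = 0)) :
  ((forall (x : 'cV[R]_nx) (l lh : 'cV[R]_nc),
      GrSOL D F (col_mx x l) ->
      SOL (D *m (A *m x + C *m l)) F lh ->
      psihat A C Pxx Pxl Pll x l lh <= 0) ->
   stable A C D F)
  /\
  ((forall (x : 'cV[R]_nx) (l lh : 'cV[R]_nc),
      GrSOL D F (col_mx x l) -> col_mx x l <> 0 ->
      SOL (D *m (A *m x + C *m l)) F lh ->
      psihat A C Pxx Pxl Pll x l lh < 0) ->
   exponentially_stable A C D F).
Proof.
have [a a0 aV] : exists2 a : R, 0 < a & forall v, GrSOL D F v ->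
    a * enorm v ^+ 2 <= qform (Pmx Pxx Pxl Pll) v.
  apply: qform_ge_enorm_cone.
  - exact: closed_GrSOL_tr.
  - by move=> t v; exact: GrSOL_scale.
  - move=> v; rewrite -(vsubmxK v) => Gv v0; have [V0 Viff] := hV _ _ Gv.
    by rewrite lt_neqAle V0 andbT eq_sym; apply/eqP => /Viff.
have [b b0 Vb] := qform_le_enorm (Pmx Pxx Pxl Pll).
(* Along a trajectory [l k.+2] plays the role of the successor multiplier [lh]. *)
have step x l k : trajectory A C D F x l ->
    SOL (D *m (A *m x k + C *m l k.+1)) F (l k.+2).
  by move=> xl; rewrite -(xl k).2; exact: (xl k.+1).1.
split => [psi_le0 eps eps0|psi_lt0].
  have s0 : 0 < Num.sqrt (b / a) by rewrite sqrtr_gt0 divr_gt0.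
  (* This radius cancels the overshoot factor of [trajectory_decay] at r = 1. *)
  exists (eps / Num.sqrt (b / a)) => [|x l xl xl0 k]; first exact: divr_gt0.
  have := @trajectory_decay _ _ _ A C D F _ _ _ a b 1 x l a0 b0 ler01 aV Vb xl.
  rewrite sqrtr1 => /(_ _ k) /le_lt_trans; apply.
    move=> {}k; rewrite mul1r (Vhat_trajectoryS _ _ _ k xl) gerDl.
    by apply: psi_le0; [exact: trajectory_GrSOL xl | exact: step].
  by rewrite expr1n mulr1 mulrC -ltr_pdivlMr.
have [g g0 gpsi] : exists2 g : R, 0 < g & forall w, step_graph A C D F w ->
    g * enorm w ^+ 2 <= qform (- Mhat A C Pxx Pxl Pll) w.
  apply: qform_ge_enorm_cone.
  - exact: closed_step_graph_tr.
  - by move=> t w; exact: step_graph_scale.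
  - move=> w [Gw Sw] w0; rewrite qformN oppr_gt0.
    (* [psi_lt0] requires a nonzero pair, whereas the cone lemma only supplies a nonzero triple. If
       the pair vanished, [lh] would lie in [SOL 0 F], which [hR0] reduces to zero. *)
    have xl0 : usubmx w <> 0.
      move=> xl0; apply: w0; move: Sw.
      rewrite xl0 !linear0 addr0 linear0 hR0 => lh0.
      by rewrite -(vsubmxK w) xl0 lh0 col_mx0.
    have := psi_lt0 _ _ (dsubmx w); rewrite -(vsubmxK (usubmx w)) in Gw xl0.
    move=> /(_ _ _ Gw xl0 Sw).
    by rewrite /psihat !vsubmxK.
(* Enlarging the upper constant from [b] to [d] ensures g / d <= 1, so that the rate 1 - g / d has a
   real square root. *)
pose d := b + g.
have d0 : 0 < d by rewrite addr_gt0.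
have Vd v : qform (Pmx Pxx Pxl Pll) v <= d * enorm v ^+ 2.
  apply: le_trans (Vb v) _; rewrite ler_wpM2r ?sqr_ge0//.
  by rewrite lerDl ltW.
have gd1 : g / d <= 1 by rewrite ler_pdivrMr// mul1r lerDr ltW.
have r0 : 0 <= 1 - g / d by rewrite subr_ge0.
(* The decay estimate is global, so the radius 1 is an arbitrary choice. *)
exists 1, (Num.sqrt (d / a)), (Num.sqrt (1 - g / d)); split => //.
- by rewrite sqrtr_gt0 divr_gt0.
- rewrite sqrtr_ge0 /= -[ltRHS]sqrtr1 ltr_sqrt//.
  by rewrite gtrBl divr_gt0.
move=> x l xl _; apply: (trajectory_decay a0 d0 r0 aV Vd xl) => k.
rewrite (Vhat_trajectoryS _ _ _ k xl) mulrBl mul1r lerD2l.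
set v := col_mx (x k) (l k.+1).
have Gw : step_graph A C D F (col_mx v (l k.+2)).
  rewrite /step_graph /= /v !col_mxKu !col_mxKd; split; last exact: step.
  exact: trajectory_GrSOL xl.
(* With [w] the triple extending [v], the decrease -psi is at least g |w|^2 >= g |v|^2 >= (g / d)
   V(v). *)
have := gpsi _ Gw; rewrite qformN lerNr => /le_trans; apply.
rewrite lerN2; apply: (@le_trans _ _ (g * enorm v ^+ 2)).
  rewrite mulrAC ler_pdivrMr// -mulrA ler_wpM2l ?(ltW g0)// [_ * d]mulrC.
  exact: Vd.
rewrite ler_wpM2l ?(ltW g0)// ler_pXn2r ?nnegrE ?enorm_ge0//.
by have := enorm_usub (col_mx v (l k.+2)); rewrite col_mxKu.
Qed.
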